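(* Let $n\geqslant 3$. Let $R_{\mathrm{sw}}$ be the set of relations on the alphabet $\{a_0,b_0,e_0,f_0,d,z,z_0\}$ consisting of all relations of $R_\mathrm{s}$ together with $$b_0z_0=z_0,\quad zz_0=z_0,\quad z_0a_0=z_0,\quad z_0b_0=z_0,\quad z_0e_0=z_0,\quad z_0f_0=z_0,\quad dz_0=dz,\quad z_0d=d(f_0b_0)^{n-1}.$$ Then the presentation $\langle a_0,b_0,e_0,f_0,d,z,z_0\mid R_{\mathrm{sw}}\rangle$ defines the monoid $\mathrm{PswEnd}(S_n)$ of all partial strong weak endomorphisms of the star graph $S_n$.
   Context: Let $\Omega_{n-1}=\{1,\ldots,n-1\}$ and $\Omega_{n-1}^0=\{0,1,\ldots,n-1\}$. $\mathcal{PT}(\Omega)$ is the monoid of all partial transformations of $\Omega$; maps are written on the right and composed from left to right. $S_n$ is the star graph with vertex set $\Omega_{n-1}^0$ and edge set $\{\{0,i\}\mid 1\leqslant i\leqslant n-1\}$. For a simple graph $G=(V,E)$, $\alpha\in\mathcal{PT}(V)$ is a partial strong weak endomorphism if, for all $u,v\in\mathrm{Dom}(\alpha)$: ($\{u,v\}\in E$ and $u\alpha\neq v\alpha$) if and only if $\{u\alpha,v\alpha\}\in E$; $\mathrm{PswEnd}(G)$ is the submonoid of $\mathcal{PT}(V)$ of all these. The letters stand for the following generators of $\mathrm{PswEnd}(S_n)$, elements of $\mathcal{PT}(\Omega_{n-1}^0)$: $a_0$ is the permutation swapping $1$ and $2$ and fixing all else; $b_0$ is the permutation with $0\mapsto 0$,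 $i\mapsto i+1$ for $1\leqslant i\leqslant n-2$, $n-1\mapsto 1$; $e_0$ is the full transformation with $2\mapsto 1$ fixing all else; $f_0$ is the partial identity with domain $\Omega_{n-1}^0\setminus\{1\}$; $d$ is the partial identity with domain $\Omega_{n-1}$; $z$ is the full transformation with $0\mapsto 1$ and $i\mapsto 0$ for $1\leqslant i\leqslant n-1$; $z_0$ is the full transformation with constant value $0$. $R_0$ is any fixed set of relations on the alphabet $\{a_0,b_0,e_0,f_0\}$ which defines, on the generators $a_0,b_0,e_0,f_0$, the monoid $\{\alpha\in\mathcal{PT}(\Omega_{n-1}^0)\mid 0\in\mathrm{Dom}(\alpha),\ 0\alpha=0,\ \Omega_{n-1}\alpha\subseteq\Omega_{n-1}\}$; that is, two words over $\{a_0,b_0,e_0,f_0\}$ are congruent modulo $R_0$ if and only if they represent the same transformation. $R_\mathrm{s}$ consists of $R_0$ together with $d^2=d$, $a_0d=da_0$, $b_0d=db_0$, $e_0d=de_0$, $f_0d=df_0$, $a_0z=z$, $b_0z=z$, $e_0z=z$, $dz=zf_0$, $zd=(f_0b_0)^{n-1}z$, $z^2=(e_0b_0)^{n-3}e_0$, $d(f_0b_0)^{n-1}z=d(f_0b_0)^{n-1}$. For an alphabet $X$, $X^*$ is the free monoid on $X$; a relation $u=v$ is a pair $(u,v)\in X^*\times X^*$; $\sim_R$ is the congruence on $X^*$ generated by $R$. A monoid $M$ is defined by the presentation $\langle X\mid R\rangle$ if $M\cong X^*/{\sim_R}$. *)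

(* Defs.v *)
From HB Require Import structures.
From mathcomp Require Import all_boot.
From mathcomp Require Import boolp.

Set Implicit Arguments.
Unset Strict Implicit.
Unset Printing Implicit Defensive.

Local Open Scope quotient_scope.
Local Open Scope group_scope.

Section FreeMonoid.
Variable X : choiceType.

Definition free_monoid : Type := seq X.
HB.instance Definition _ := Choice.on free_monoid.

Fact free_monoid_mulA : associative (@cat X : free_monoid -> _ -> _).
Proof. exact: catA. Qed.
Fact free_monoid_mul1 : left_id ([::] : free_monoid) (@cat X).
Proof. exact: cat0s. Qed.
Fact free_monoid_mulr1 : right_id ([::] : free_monoid) (@cat X).
Proof. exact: cats0. Qed.
HB.instance Definition _ :=
  isMonoid.Build free_monoid free_monoid_mulA free_monoid_mul1
    free_monoid_mulr1.

Definition letter_word (x : X) : free_monoid := [:: x].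

Definition relations := free_monoid -> free_monoid -> Prop.

Inductive congruence (R : relations) : relations :=
| cong_rel u v : R u v -> congruence R u v
| cong_refl u : congruence R u u
| cong_sym u v : congruence R u v -> congruence R v u
| cong_trans u v w : congruence R u v -> congruence R v w -> congruence R u w
| cong_mul u u' v v' : congruence R u u' -> congruence R v v' ->
    congruence R (u * v) (u' * v').

Definition word_eval (M : monoidType) (g : X -> M) (w : free_monoid) : M :=
  \prod_(x <- w) g x.

End FreeMonoid.

Section Presentation.
Variables (X : choiceType) (R : relations X).

Definition congruent : rel (free_monoid X) := fun u v => `[< congruence R u v >].

Fact congruent_refl : reflexive congruent.
Proof. by move=> u; apply/asboolP; apply: cong_refl. Qed.
Fact congruent_sym : symmetric congruent.
Proof. by move=> u v; apply/asboolP/asboolP; apply: cong_sym. Qed.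
Fact congruent_trans : transitive congruent.
Proof.
by move=> v u w /asboolP uv /asboolP vw; apply/asboolP; apply: cong_trans vw.
Qed.

Canonical congruent_equiv :=
  EquivRel congruent congruent_refl congruent_sym congruent_trans.

Definition presented : Type := {eq_quot congruent}.
HB.instance Definition _ := Choice.on presented.
HB.instance Definition _ := EqQuotient.on presented.

Definition word_class (w : free_monoid X) : presented := \pi_presented w.

Lemma word_classP u v : word_class u = word_class v <-> congruence R u v.
Proof. by split=> [/eqmodP/asboolP|uv] //; apply/eqmodP/asboolP. Qed.

Definition presented_mul (p q : presented) : presented :=
  word_class (repr p * repr q).

Lemma word_classM u v :
  presented_mul (word_class u) (word_class v) = word_class (u * v).
Proof.
by apply/word_classP; apply: cong_mul; apply/word_classP; rewrite /word_class reprK.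
Qed.

Lemma word_class_ind (P : presented -> Prop) :
  (forall w, P (word_class w)) -> forall p, P p.
Proof. by move=> Pw p; rewrite -[p]reprK; apply: Pw. Qed.

Fact presented_mulA : associative presented_mul.
Proof.
elim/word_class_ind=> u; elim/word_class_ind=> v; elim/word_class_ind=> w.
by rewrite !word_classM mulgA.
Qed.
Fact presented_mul1 : left_id (word_class 1) presented_mul.
Proof. by elim/word_class_ind=> u; rewrite word_classM mul1g. Qed.
Fact presented_mulr1 : right_id (word_class 1) presented_mul.
Proof. by elim/word_class_ind=> u; rewrite word_classM mulg1. Qed.
HB.instance Definition _ :=
  isMonoid.Build presented presented_mulA presented_mul1 presented_mulr1.

End Presentation.

Section PartialTransformations.
Variable V : finType.

(* [f x = None] means that x is not in the domain of f. *)
Definition ptransf : Type := {ffun V -> option V}.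
HB.instance Definition _ := Finite.on ptransf.

(* Maps act on the right: x(fg) = (xf)g. *)
Definition ptransf_mul (f g : ptransf) : ptransf :=
  [ffun x => obind g (f x)].
Definition ptransf_one : ptransf := [ffun x => Some x].

Fact ptransf_mulA : associative ptransf_mul.
Proof. by move=> f g h; apply/ffunP=> x; rewrite !ffunE; case: (f x) => //= y; rewrite ffunE. Qed.
Fact ptransf_mul1 : left_id ptransf_one ptransf_mul.
Proof. by move=> f; apply/ffunP=> x; rewrite !ffunE. Qed.
Fact ptransf_mulr1 : right_id ptransf_one ptransf_mul.
Proof. by move=> f; apply/ffunP=> x; rewrite !ffunE; case: (f x) => //= y; rewrite ffunE. Qed.
HB.instance Definition _ :=
  isMonoid.Build ptransf ptransf_mulA ptransf_mul1 ptransf_mulr1.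

End PartialTransformations.

Record sgraph := SGraph {
  vertex : finType;
  edge : rel vertex;
  edge_sym : symmetric edge;
  edge_irrefl : irreflexive edge }.

Section PswEnd.
Variable G : sgraph.

Definition is_psw_end : {pred ptransf (vertex G)} := fun f =>
  [forall u, forall v,
    if (f u, f v) is (Some u', Some v')
    then (edge u v && (u' != v')) == edge u' v'
    else true].

Fact is_psw_end_closed : monoid_closed is_psw_end.
Proof.
split=> [|f g /forallP fP /forallP gP].
  apply/forallP=> u; apply/forallP=> v; rewrite !ffunE.
  by case: (eqVneq u v) => [->|_]; rewrite ?edge_irrefl ?andbT.
apply/forallP=> u; apply/forallP=> v; rewrite !ffunE.
move: (fP u) => /forallP/(_ v).
case: (f u) (f v) => [u'|] [v'|] //=; last by case: (g u').
move: (gP u') => /forallP/(_ v').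
case Eu: (g u') => [u2|]; case Ev: (g v') => [v2|] //= /eqP<- /eqP<-.
case: (eqVneq u' v') Eu => [-> | _ _]; last by rewrite andbT.
by rewrite Ev => -[->]; rewrite eqxx !andbF.
Qed.

Record psw_end := PswEnd { psw_val :> ptransf (vertex G); _ : is_psw_end psw_val }.
HB.instance Definition _ := [isSub for psw_val].
HB.instance Definition _ := [Choice of psw_end by <:].
HB.instance Definition _ :=
  SubChoice_isSubMonoid.Build _ is_psw_end psw_end is_psw_end_closed.

End PswEnd.

Local Open Scope nat_scope.

Section Star.
Variable n : nat.

Definition star_edge : rel 'I_n :=
  fun i j => (i != j) && ((val i == 0) || (val j == 0)).

Fact star_edge_sym : symmetric star_edge.
Proof. by move=> i j; rewrite /star_edge eq_sym orbC. Qed.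
Fact star_edge_irrefl : irreflexive star_edge.
Proof. by move=> i; rewrite /star_edge eqxx. Qed.

Definition star : sgraph := SGraph star_edge_sym star_edge_irrefl.

End Star.

Variant base_letter := La0 | Lb0 | Le0 | Lf0.
Variant letter := Base of base_letter | Ld | Lz | Lz0.

Definition base_letter_code (x : base_letter) : nat :=
  match x with La0 => 0 | Lb0 => 1 | Le0 => 2 | Lf0 => 3 end.
Definition base_letter_decode (k : nat) : base_letter :=
  match k with 0 => La0 | 1 => Lb0 | 2 => Le0 | _ => Lf0 end.
Fact base_letter_codeK : cancel base_letter_code base_letter_decode.
Proof. by case. Qed.
HB.instance Definition _ :=
  Choice.copy base_letter (can_type base_letter_codeK).

Definition letter_code (x : letter) : base_letter + nat :=
  match x with
  | Base y => inl y | Ld => inr 0 | Lz => inr 1 | Lz0 => inr 2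
  end.
Definition letter_decode (c : base_letter + nat) : letter :=
  match c with
  | inl y => Base y | inr 0 => Ld | inr 1 => Lz | inr _ => Lz0
  end.
Fact letter_codeK : cancel letter_code letter_decode.
Proof. by case. Qed.
HB.instance Definition _ := Choice.copy letter (can_type letter_codeK).

(* The image [f i] is only used when it is smaller than n; this is always the
   case for the generators below as soon as 3 <= n. *)
Definition ptransf_of_nat (n : nat) (f : nat -> option nat) : ptransf 'I_n :=
  [ffun i : 'I_n => obind insub (f i)].

Definition base_gen (n : nat) (x : base_letter) : ptransf 'I_n :=
  ptransf_of_nat n (fun i : nat =>
    match x with
    | La0 => Some (if i == 1 then 2 else if i == 2 then 1 else i)
    | Lb0 => Some (if i == 0 then 0 else if i == n.-1 then 1 else i.+1)
    | Le0 => Some (if i == 2 then 1 else i)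
    | Lf0 => if i == 1 then None else Some i
    end).

Definition gen (n : nat) (x : letter) : ptransf 'I_n :=
  match x with
  | Base y => base_gen n y
  | Ld => ptransf_of_nat n (fun i => if i == 0 then None else Some i)
  | Lz => ptransf_of_nat n (fun i => Some (if i == 0 then 1 else 0))
  | Lz0 => ptransf_of_nat n (fun=> Some 0)
  end.

Definition base_word (w : free_monoid base_letter) : free_monoid letter :=
  map Base w.

Section Relations.
Local Open Scope group_scope.
Variables (n : nat) (R0 : relations base_letter).

Local Notation a0 := (letter_word (Base La0)).
Local Notation b0 := (letter_word (Base Lb0)).
Local Notation e0 := (letter_word (Base Le0)).
Local Notation f0 := (letter_word (Base Lf0)).
Local Notation d := (letter_word Ld).
Local Notation z := (letter_word Lz).
Local Notation z0 := (letter_word Lz0).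

Variant Rs : relations letter :=
| Rs_R0 u v : R0 u v -> Rs (base_word u) (base_word v)
| Rs_dd : Rs (d ^+ 2) d
| Rs_ad : Rs (a0 * d) (d * a0)
| Rs_bd : Rs (b0 * d) (d * b0)
| Rs_ed : Rs (e0 * d) (d * e0)
| Rs_fd : Rs (f0 * d) (d * f0)
| Rs_az : Rs (a0 * z) z
| Rs_bz : Rs (b0 * z) z
| Rs_ez : Rs (e0 * z) z
| Rs_dz : Rs (d * z) (z * f0)
| Rs_zd : Rs (z * d) ((f0 * b0) ^+ (n - 1)%N * z)
| Rs_zz : Rs (z ^+ 2) ((e0 * b0) ^+ (n - 3)%N * e0)
| Rs_dfbz : Rs (d * (f0 * b0) ^+ (n - 1)%N * z) (d * (f0 * b0) ^+ (n - 1)%N).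

Variant Rsw : relations letter :=
| Rsw_Rs u v : Rs u v -> Rsw u v
| Rsw_bz0 : Rsw (b0 * z0) z0
| Rsw_zz0 : Rsw (z * z0) z0
| Rsw_z0a : Rsw (z0 * a0) z0
| Rsw_z0b : Rsw (z0 * b0) z0
| Rsw_z0e : Rsw (z0 * e0) z0
| Rsw_z0f : Rsw (z0 * f0) z0
| Rsw_dz0 : Rsw (d * z0) (d * z)
| Rsw_z0d : Rsw (z0 * d) (d * (f0 * b0) ^+ (n - 1)%N).

End Relations.

(* Main.v *)
(* Write M0 for the submonoid defined by R0, c = (f0 b0)^(n-1) and
   e = (e0 b0)^(n-3) e0, so that e maps every i >= 1 to 1 and e z = z = z e,
   z z = e hold in the presented monoid. Hence w z and w z0 depend only on w e,
   and z w only on e w, as elements of M0. With N = {w, w z0 | w in M0}, the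
   relations push every word into one of the normal forms x, d x and x z t, where
   x is in N and t in M0 is total, and the image of 0 tells the three apart.
   Equality of values implies equality of normal forms: on N by R0, for d x by
   restoring 0, and for x z t by multiplying by z, as x z t z = x e is in N and
   x z = (x e) z. Conversely M0 is generated by a0, b0, e0, f0, and a strong weak
   endomorphism alpha is d alpha' with 0 alpha' = 0 when 0 is not in its domain,
   and alpha t z z t with t = (1 k) when 0 alpha = k != 0; those fixing 0 lie in N. *)
Require Import Defs.
From HB Require Import structures.
From mathcomp Require Import all_boot all_fingroup zify.
From mathcomp Require Import boolp.

Set Implicit Arguments.
Unset Strict Implicit.
Unset Printing Implicit Defensive.

Local Open Scope group_scope.

(** * Evaluation of words and its compatibility with congruences *)

Lemma ptransf_mulE (V : finType) (f g : ptransf V) x :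
  (f * g) x = obind g (f x).
Proof. exact: ffunE. Qed.

Lemma ptransf_oneE (V : finType) (x : V) : (1 : ptransf V) x = Some x.
Proof. exact: ffunE. Qed.

Lemma word_eval1 (X : choiceType) (M : monoidType) (g : X -> M) :
  word_eval g 1 = 1.
Proof. exact: big_nil. Qed.

Lemma word_eval_letter (X : choiceType) (M : monoidType) (g : X -> M) x :
  word_eval g (letter_word x) = g x.
Proof. exact: big_seq1. Qed.

Lemma word_evalM (X : choiceType) (M : monoidType) (g : X -> M) u v :
  word_eval g (u * v) = word_eval g u * word_eval g v.
Proof. exact: big_cat. Qed.

Lemma word_evalX (X : choiceType) (M : monoidType) (g : X -> M) u k :
  word_eval g (u ^+ k) = word_eval g u ^+ k.
Proof. by elim: k => [|k IHk]; rewrite ?word_eval1 // !expgS word_evalM IHk. Qed.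

Lemma word_eval_base (M : monoidType) (g : letter -> M) w :
  word_eval g (base_word w) = word_eval (g \o Base) w.
Proof. exact: big_map. Qed.

Lemma base_wordM u v : base_word (u * v) = base_word u * base_word v.
Proof. exact: map_cat. Qed.

Lemma base_wordX u k : base_word (u ^+ k) = base_word u ^+ k.
Proof. by elim: k => [//|k IHk]; rewrite !expgS base_wordM IHk. Qed.

Lemma congruence_sound (X : choiceType) (M : monoidType) (g : X -> M)
    (R : relations X) :
  (forall u v, R u v -> word_eval g u = word_eval g v) ->
  forall u v, congruence R u v -> word_eval g u = word_eval g v.
Proof.
move=> Rg u v; elim=> {u v} [u v /Rg //|//|u v _ -> //|u v w _ -> _ //|].
by move=> u u' v v' _ IHu _ IHv; rewrite !word_evalM IHu IHv.
Qed.

(** * Partial transformations induced by functions on natural numbers *)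

Section PartialMapsOfNat.
Variable n : nat.
Implicit Types (f g : nat -> option nat) (i j : 'I_n).

Lemma ptransf_of_natE f i j : ptransf_of_nat n f i = Some j -> f i = Some (j : nat).
Proof. by rewrite ffunE; case: (f i) => //= k; case: insubP => // j' _ <- [->]. Qed.

Lemma ptransf_of_nat_Some f i k :
  f i = Some k -> k < n -> exists2 j, ptransf_of_nat n f i = Some j & val j = k.
Proof. by move=> fi kn; exists (Ordinal kn); rewrite // ffunE fi /= insubT. Qed.

Lemma eq_ptransf_of_nat f g :
  (forall k, k < n -> f k = g k) -> ptransf_of_nat n f = ptransf_of_nat n g.
Proof. by move=> fg; apply/ffunP=> i; rewrite !ffunE fg. Qed.

(** [insub] turns values outside ['I_n] into undefined ones, so the product can be computed on
    naturals only when the intermediate values stay below [n]. *)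
Lemma ptransf_of_natM f g :
  (forall k l, k < n -> f k = Some l -> l < n) ->
  ptransf_of_nat n f * ptransf_of_nat n g =
  ptransf_of_nat n (fun k => obind g (f k)).
Proof.
move=> fP; apply/ffunP=> i; rewrite ptransf_mulE !ffunE.
case Ef: (f i) => [l|] //=; have ln := fP _ _ (ltn_ord i) Ef.
by rewrite insubT /= ffunE.
Qed.

End PartialMapsOfNat.

(** Untyped form of the generators: identities between their products become case analyses on
    naturals that [lia] can settle. *)
Definition gen_nat (n : nat) (x : letter) (i : nat) : option nat :=
  match x with
  | Base La0 => Some (if i == 1%N then 2 else if i == 2 then 1%N else i)
  | Base Lb0 => Some (if i == 0 then 0 else if i == n.-1 then 1%N else i.+1)
  | Base Le0 => Some (if i == 2 then 1%N else i)
  | Base Lf0 => if i == 1%N then None else Some i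
  | Ld => if i == 0 then None else Some i
  | Lz => Some (if i == 0 then 1%N else 0)
  | Lz0 => Some 0
  end.

Lemma genE n x : gen n x = ptransf_of_nat n (gen_nat n x).
Proof. by case: x => [[]|||]. Qed.

Section Star.
Variable n : nat.
Hypothesis n_ge3 : 3 <= n.

Local Notation PT := (ptransf 'I_n).
Local Notation ev := (word_eval (gen n) : free_monoid letter -> PT).
Local Notation bev := (word_eval (base_gen n) : free_monoid base_letter -> PT).

Lemma gen_nat_lt x k l : k < n -> gen_nat n x k = Some l -> l < n.
Proof. by case: x => [[]|||] /=; do ?[case: eqP => ?] => // ? [<-] //; lia. Qed.

Lemma genM x y :
  gen n x * gen n y =
  ptransf_of_nat n (fun k => obind (gen_nat n y) (gen_nat n x k)).
Proof. by rewrite !genE ptransf_of_natM // => k l; apply: gen_nat_lt. Qed.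

Lemma gen_base x : gen n (Base x) = base_gen n x. Proof. by []. Qed.

Lemma ev_base w : ev (base_word w) = bev w.
Proof. exact: word_eval_base. Qed.

(** * The submonoid defined by [R0], and the values of the words c and e *)

Lemma ord0_proof : 0 < n. Proof. lia. Qed.
Lemma ord1_proof : 1 < n. Proof. lia. Qed.
Definition o0 := Ordinal ord0_proof.
Definition o1 := Ordinal ord1_proof.

(* Membership in the monoid defined by R0. *)
Definition base_tr (f : PT) :=
  f o0 = Some o0 /\ forall i, i != o0 -> f i != Some o0.

Lemma neq_o0 (i : 'I_n) : (i != o0) = (i != 0 :> nat).
Proof. by []. Qed.

Lemma base_tr1 : base_tr 1.
Proof. by split=> [|i]; rewrite ptransf_oneE. Qed.

Lemma base_trM f g : base_tr f -> base_tr g -> base_tr (f * g).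
Proof.
move=> [f0 fP] [g0 gP]; split=> [|i /fP]; rewrite ptransf_mulE ?f0 //.
by case: (f i) => //= j j0; apply: gP; apply: contra_neq j0 => ->.
Qed.

Lemma base_tr_gen x : base_tr (base_gen n x).
Proof.
rewrite -gen_base genE; split=> [|i].
  have [|//|j ->] := @ptransf_of_nat_Some n (gen_nat n (Base x)) o0 0.
  - by case: x.
  - by rewrite ord0_proof.
  by move=> j0; congr Some; apply: val_inj.
rewrite neq_o0 => i0; apply/eqP=> /ptransf_of_natE.
by case: x => /=; do ?[case: eqP => ?] => // /Some_inj /=; lia.
Qed.

Lemma base_tr_bev w : base_tr (bev w).
Proof.
elim: w => [|x w IHw]; first by rewrite word_eval1; apply: base_tr1.
by rewrite -[x :: w]/(letter_word x * w) word_evalM word_eval_letter;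
  apply: base_trM (base_tr_gen x) IHw.
Qed.

(* Locked so that rewriting with [word_evalM] does not unfold these two words. *)
Definition cw : free_monoid base_letter :=
  locked ((letter_word Lf0 * letter_word Lb0) ^+ (n - 1)%N).
Definition ew : free_monoid base_letter :=
  locked ((letter_word Le0 * letter_word Lb0) ^+ (n - 3)%N * letter_word Le0).

(** Each factor deletes 1, shifts the rest up by one and wraps n - 1 to 1. A survivor is therefore
    either freshly wrapped, and deleted next, or has been shifted k times from a point at least
    2. *)
Lemma fb_power k (i j : 'I_n) : i != o0 ->
  ((base_gen n Lf0 * base_gen n Lb0) ^+ k) i = Some j ->
  j = 1%N :> nat \/ k.+1 < j.
Proof.
rewrite neq_o0 => i0; elim: k j => [|k IHk] j.
  by rewrite expg0 ptransf_oneE => -[<-]; lia.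
rewrite expgSr ptransf_mulE; case Ei: (_ i) => [l|] //= lj.
have {}IHk := IHk _ Ei.
move: lj; rewrite -!gen_base genM => /ptransf_of_natE /=.
by have := ltn_ord l; do ?[case: eqP => ? /=] => // ? []; lia.
Qed.

Lemma bev_cw : bev cw = ptransf_of_nat n (fun k => if k == 0 then Some 0 else None).
Proof.
apply/ffunP=> i; have [->|i0] := eqVneq i o0.
  rewrite (base_tr_bev cw).1 ffunE /= insubT //= ?ord0_proof //.
  by move=> ?; congr Some; apply: val_inj.
rewrite [RHS]ffunE -[_ == 0]/(i == o0) (negbTE i0) /=.
case Ei: (bev cw i) => [j|] //; exfalso; move: Ei.
rewrite /cw -lock word_evalX word_evalM !word_eval_letter.
(* After n - 2 factors no value can exceed n - 1, so by [fb_power] only 1 is left, and the last [f0]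
   deletes it. *)
rewrite (_ : (n - 1)%N = (n - 2).+1%N); last lia.
rewrite expgSr ptransf_mulE; case Ei: (_ i) => [l|] //= lj.
have := fb_power i0 Ei.
move: lj; rewrite -!gen_base genM => /ptransf_of_natE /=.
by have := ltn_ord l; case: eqP => ? //=; lia.
Qed.

(** The set {1, 2} is absorbed into 2 by each factor, while a larger point moves up until it wraps
    to 1. For k = n - 3 only the values 1 and 2 remain, and one more [e0] merges them. *)
Lemma eb_power k (i : 'I_n) : i != o0 ->
  exists2 j : 'I_n, ((base_gen n Le0 * base_gen n Lb0) ^+ k) i = Some j &
    0 < j /\ (j <= 2 \/ k.+2 < j).
Proof.
rewrite neq_o0 => i0; elim: k => [|k [j Ej jP]].
  by exists i; rewrite ?expg0 ?ptransf_oneE //; lia.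
(* The product [e0 b0] sends 1 and 2 to 2, and acts on larger points as [b0]. *)
have [||l El lP] := @ptransf_of_nat_Some n
    (fun k => obind (gen_nat n (Base Lb0)) (gen_nat n (Base Le0) k)) j
    (if (j == 1%N :> nat) || (j == 2 :> nat) then 2
     else if j == n.-1 :> nat then 1%N else j.+1).
- by move: (ltn_ord j) jP; case: (nat_of_ord j) => [|[|[|m]]] /=;
    do ?[case: eqP => ? /=] => // ? ?; first [congr Some; lia | exfalso; lia].
- move: (ltn_ord j) jP; case: (nat_of_ord j) => [|[|[|m]]] /=;
    do ?[case: eqP => ? /=]; lia.
exists l; first by rewrite expgSr ptransf_mulE Ej /= -!gen_base genM.
by move: lP (ltn_ord j) jP; case: (nat_of_ord j) => [|[|[|m]]] /=;
  do ?[case: eqP => ? /=]; lia.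
Qed.

Lemma bev_ew :
  bev ew = ptransf_of_nat n (fun k => Some (if k == 0 then 0 else 1%N)).
Proof.
apply/ffunP=> i; have [->|i0] := eqVneq i o0.
  rewrite (base_tr_bev ew).1 ffunE /= insubT //= ?ord0_proof //.
  by move=> ?; congr Some; apply: val_inj.
rewrite [RHS]ffunE -[_ == 0]/(i == o0) (negbTE i0) /= insubT ?ord1_proof //.
move=> n1; rewrite /ew -lock word_evalM word_evalX word_evalM !word_eval_letter.
rewrite ptransf_mulE; have [j -> jP /=] := eb_power (n - 3)%N i0.
rewrite -gen_base genE ffunE.
have -> : gen_nat n (Base Le0) j = Some 1%N.
  by move: (ltn_ord j); rewrite /=; case: eqP => // ? ?; congr Some; lia.
by rewrite /= insubT; congr Some; apply: val_inj.
Qed.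

(** * Generators as strong weak endomorphisms, and soundness of the relations *)

Lemma is_pswP (f : PT) :
  reflect (forall u v u' v', f u = Some u' -> f v = Some v' ->
             star_edge u v && (u' != v') = star_edge u' v')
          (is_psw_end (G := star n) f).
Proof.
apply: (iffP forallP) => [fP u v u' v' fu fv|fP u].
  by have /forallP/(_ v) := fP u; rewrite fu fv => /eqP.
by apply/forallP=> v; case fu: (f u) => [u'|] //; case fv: (f v) => [v'|] //;
   apply/eqP; apply: fP fu fv.
Qed.

Lemma gen_psw x : is_psw_end (G := star n) (gen n x).
Proof.
apply/is_pswP=> u v u' v'; rewrite genE => /ptransf_of_natE fu /ptransf_of_natE.
move: fu; rewrite /star_edge -!val_eqE /=.
have := ltn_ord u; have := ltn_ord v.
case: x => [[]|||] /=.
all: by do ?[case: (eqVneq (nat_of_ord _) _) => ? //=];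
  move=> ? ? /Some_inj ? /Some_inj ?; lia.
Qed.

Lemma Rsw_sound (R0 : relations base_letter)
    (R0_sound : forall u v, R0 u v -> bev u = bev v) u v :
  Rsw n R0 u v -> ev u = ev v.
Proof.
have evC : ev ((letter_word (Base Lf0) * letter_word (Base Lb0)) ^+ (n - 1)%N) =
    ptransf_of_nat n (fun k => if k == 0 then Some 0 else None).
  by rewrite -bev_cw -ev_base /cw -lock base_wordX base_wordM.
have evE : ev ((letter_word (Base Le0) * letter_word (Base Lb0)) ^+ (n - 3)%N *
               letter_word (Base Le0)) =
    ptransf_of_nat n (fun k => Some (if k == 0 then 0 else 1%N)).
  by rewrite -bev_ew -ev_base /ew -lock base_wordM base_wordX base_wordM.
case=> {u v} [_ _ [u v /R0_sound uv||||||||||||]||||||||];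
  first by rewrite !ev_base.
all: rewrite ?evE ?word_evalM ?evC ?expgS ?expg0 ?mulg1 ?word_evalM.
all: rewrite ?word_eval_letter ?genE ?ptransf_of_natM;
  try by move=> ? ? /=; do ?[case: eqP => ? /=] => // ? /Some_inj; lia.
(* The exceptional points of the generators are 0, 1, 2, and n - 1, where [b0] wraps around. *)
all: apply: eq_ptransf_of_nat => k kn.
all: by case: k kn => [|[|[|k]]] kn /=; do ?[case: (_ =P n.-1) => ? /=] => //;
  first [congr Some; lia | exfalso; lia].
Qed.


(** * Generation of the submonoid fixing 0 by a0, b0, e0, f0 *)

Definition base_generated (f : PT) := exists w, bev w = f.

Lemma base_generated1 : base_generated 1.
Proof. by exists 1; rewrite word_eval1. Qed.

Lemma base_generatedM f g :
  base_generated f -> base_generated g -> base_generated (f * g).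
Proof. by move=> [u <-] [v <-]; exists (u * v); rewrite word_evalM. Qed.

Lemma base_generated_gen x : base_generated (base_gen n x).
Proof. by exists (letter_word x); rewrite word_eval_letter. Qed.

Definition perm_tr (s : {perm 'I_n}) : PT := [ffun i => Some (s i)].

Lemma perm_trE s i : perm_tr s i = Some (s i). Proof. exact: ffunE. Qed.

Lemma perm_trM s t : perm_tr (s * t) = perm_tr s * perm_tr t.
Proof. by apply/ffunP=> i; rewrite ptransf_mulE !perm_trE /= perm_trE permM. Qed.

Lemma perm_tr1 : perm_tr 1 = 1.
Proof. by apply/ffunP=> i; rewrite perm_trE ptransf_oneE perm1. Qed.

(** In a finite group the inverse of s is a positive or trivial power of s. *)
Lemma base_generatedV s : base_generated (perm_tr s) -> base_generated (perm_tr s^-1).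
Proof.
rewrite invg_expg => gs; elim: #[s].-1 => [|k IHk].
  by rewrite expg0 perm_tr1; apply: base_generated1.
by rewrite expgS perm_trM; apply: base_generatedM.
Qed.

(** The identity altered at one point: [f0] and [e0] have this form, and conjugation by permutations
    yields the others. *)
Definition upd (i : 'I_n) (o : option 'I_n) : PT :=
  [ffun x => if x == i then o else Some x].

Lemma updE i o x : upd i o x = if x == i then o else Some x.
Proof. exact: ffunE. Qed.

Lemma upd_conj s i o : perm_tr s^-1 * upd i o * perm_tr s = upd (s i) (omap s o).
Proof.
apply/ffunP=> x; rewrite 2!ptransf_mulE perm_trE /= !updE.
rewrite -(inj_eq (@perm_inj _ s)) permKV; case: eqP => _.
  by case: o => //= j; rewrite perm_trE.
by rewrite /= perm_trE permKV.
Qed.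

Lemma base_generated_upd_conj s i o : base_generated (perm_tr s) ->
  base_generated (upd i o) -> base_generated (upd (s i) (omap s o)).
Proof.
move=> gs gu; rewrite -upd_conj.
by do 2?apply: base_generatedM => //; apply: base_generatedV.
Qed.

Lemma ord2_proof : 2 < n. Proof. lia. Qed.
Definition o2 := Ordinal ord2_proof.

(** The map underlying [b0]. The default of [insubd] is never reached, since in the last branch
    [i.+1 < n]. *)
Definition succ_fun (i : 'I_n) : 'I_n :=
  if i == o0 then o0 else if i == n.-1 :> nat then o1 else insubd o0 i.+1.

Lemma succ_funE (i : 'I_n) :
  succ_fun i = (if i == 0 :> nat then 0
                else if i == n.-1 :> nat then 1%N else i.+1) :> nat.
Proof.
rewrite /succ_fun; case: (eqVneq i o0) => [-> //|]; rewrite neq_o0 => i0.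
rewrite (negbTE i0); case: eqP => // ?.
by rewrite val_insubd ifT //; have := ltn_ord i; lia.
Qed.

Lemma succ_fun_inj : injective succ_fun.
Proof.
move=> i j /(congr1 (@nat_of_ord n)); rewrite !succ_funE => ij.
apply: val_inj => /=; move: ij; have := ltn_ord i; have := ltn_ord j.
by do ?[case: (nat_of_ord _ =P _)]; lia.
Qed.

Definition succ_perm : {perm 'I_n} := perm succ_fun_inj.

Lemma succ_permE (i : 'I_n) :
  succ_perm i = (if i == 0 :> nat then 0
                 else if i == n.-1 :> nat then 1%N else i.+1) :> nat.
Proof. by rewrite permE succ_funE. Qed.

Lemma perm_tr_succ : perm_tr succ_perm = base_gen n Lb0.
Proof.
apply/ffunP=> i; rewrite perm_trE ffunE /= -succ_permE insubT //= => ?.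
by congr Some; apply: val_inj.
Qed.

Lemma perm_tr_swap : perm_tr (tperm o1 o2) = base_gen n La0.
Proof.
apply/ffunP=> i; rewrite perm_trE ffunE /=.
have -> : (if i == 1%N :> nat then 2 else if i == 2 :> nat then 1%N else i) =
          tperm o1 o2 i.
  case: tpermP => [->|->|/eqP i1 /eqP i2] //=.
  by rewrite -[_ == 1%N]/(i == o1) -[_ == 2]/(i == o2) (negbTE i1) (negbTE i2).
by rewrite insubT //= => ?; congr Some; apply: val_inj.
Qed.

Lemma upd_f : upd o1 None = base_gen n Lf0.
Proof.
apply/ffunP=> i; rewrite updE ffunE /= -[_ == 1%N]/(i == o1).
by case: eqP => //= _; rewrite insubT //= => ?; congr Some; apply: val_inj.
Qed.

Lemma upd_e : upd o2 (Some o1) = base_gen n Le0.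
Proof.
apply/ffunP=> i; rewrite updE ffunE /= -[_ == 2]/(i == o2).
case: eqP => _ /=.
  by rewrite insubT ?ord1_proof //= => ?; congr Some; apply: val_inj.
by rewrite insubT //= => ?; congr Some; apply: val_inj.
Qed.

(* [succ_perm] moves any point to 1, and [succ_perm * (1 2)] fixes 1 and
   cycles the remaining points of Omega_(n-1). *)
Lemma two_transitive_ind (P : 'I_n -> 'I_n -> Prop) :
  P o1 o2 ->
  (forall i j, P i j -> P (succ_perm i) (succ_perm j)) ->
  (forall i j, P i j ->
     P ((succ_perm * tperm o1 o2) i) ((succ_perm * tperm o1 o2) j)) ->
  forall i j, i != o0 -> j != o0 -> i != j -> P i j.
Proof.
move=> P12 Ps Pc.
(* Pairs with first entry 1: the permutation fixing 1 takes k + 2 to k + 3. *)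
have P1 k (j : 'I_n) : j = k.+2 :> nat -> P o1 j.
  elim: k j => [|k IHk] j jk; first by rewrite (_ : j = o2) //; apply: val_inj.
  have k2n : k.+2 < n by have := ltn_ord j; lia.
  have := Pc _ _ (IHk (Ordinal k2n) erefl); rewrite !permM.
  have -> : succ_perm o1 = o2.
    by apply: val_inj; rewrite /= succ_permE /=; case: eqP; lia.
  have -> : succ_perm (Ordinal k2n) = j.
    by apply: val_inj; rewrite /= succ_permE /= jk; have := ltn_ord j; case: eqP; lia.
  by rewrite tpermR tpermD // -val_eqE /= jk.
(* Any other first entry is lowered by one by pulling both entries back along [succ_perm]. *)
have PS k (i j : 'I_n) : i = k.+1 :> nat -> j != o0 -> i != j -> P i j.
  elim: k i j => [|k IHk] i j ik j0 ij.
    have i1 : i = o1 by apply: val_inj.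
    rewrite i1; apply: (P1 (j - 2)%N).
    by move: ij j0; rewrite -!val_eqE /= ik; lia.
  have kn : k.+1 < n by have := ltn_ord i; lia.
  have si : succ_perm (Ordinal kn) = i.
    by apply: val_inj; rewrite /= succ_permE /= ik; have := ltn_ord i; case: eqP; lia.
  have s0 : succ_perm o0 = o0 by apply: val_inj; rewrite /= succ_permE.
  rewrite -si -(permKV succ_perm j); apply: Ps; apply: IHk => //.
    by rewrite -(inj_eq (@perm_inj _ succ_perm)) permKV s0.
  by rewrite -(inj_eq (@perm_inj _ succ_perm)) permKV si.
move=> i j i0 j0 ij; apply: (PS i.-1) => //.
by move: i0; rewrite neq_o0; lia.
Qed.

(** For the pair (1, 2) these are [a0] and [e0]; every other ordered pair of distinct nonzero points
    is reached by conjugating with generated permutations. *)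
Lemma base_generated_tperm_upd i j : i != o0 -> j != o0 -> i != j ->
  base_generated (perm_tr (tperm i j)) /\ base_generated (upd j (Some i)).
Proof.
have gb : base_generated (perm_tr succ_perm).
  by rewrite perm_tr_succ; apply: base_generated_gen.
have ga : base_generated (perm_tr (tperm o1 o2)).
  by rewrite perm_tr_swap; apply: base_generated_gen.
have conj s k l : base_generated (perm_tr s) ->
  base_generated (perm_tr (tperm k l)) /\ base_generated (upd l (Some k)) ->
  base_generated (perm_tr (tperm (s k) (s l))) /\
  base_generated (upd (s l) (Some (s k))).
  move=> gs [gt gu]; split; last exact: (base_generated_upd_conj gs gu).
  rewrite -tpermJ conjgE !perm_trM.
  by apply: base_generatedM (base_generatedV gs) _; apply: base_generatedM.
move: i j; apply: two_transitive_ind => [|k l|k l]; last 2 first.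
- exact: conj.
- by apply: conj; rewrite perm_trM; apply: base_generatedM.
by rewrite upd_e; split=> //; apply: base_generated_gen.
Qed.

Lemma base_generated_updN i : i != o0 -> base_generated (upd i None).
Proof.
have gb : base_generated (perm_tr succ_perm).
  by rewrite perm_tr_succ; apply: base_generated_gen.
rewrite neq_o0; case: i => -[|k] //= kn _.
elim: k kn => [|k IHk] kn.
  rewrite (_ : Ordinal kn = o1); last exact: val_inj.
  by rewrite upd_f; apply: base_generated_gen.
have kn' : k.+1 < n by lia.
have := base_generated_upd_conj gb (IHk kn').
congr (base_generated (upd _ _)); apply: val_inj.
by rewrite /= succ_permE /=; case: eqP; lia.
Qed.

Definition moved (f : PT) := [set x | f x != Some x].

(* If a point x is not in the image of f, then f = g * upd x (f x), where g fixes
   x and agrees with f elsewhere; otherwise f is a permutation, which is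
   corrected by a transposition. Both steps fix one more point. *)
Lemma base_generated_base_tr f : base_tr f -> base_generated f.
Proof.
elim: {f}_.+1 {-2}f (ltnSn #|moved f|) => // m IHm f fm [f0 fP].
have decr (g : PT) x : f x != Some x -> g x = Some x ->
    (forall y, f y = Some y -> g y = Some y) -> #|moved g| < m.
  move=> fx gx fg; apply: (@leq_trans #|moved f|) fm.
  apply: proper_card; apply/properP; split.
    by apply/subsetP=> y; rewrite !inE; apply: contra_neq => /fg.
  by exists x; rewrite inE ?gx ?eqxx.
have [ontof|] := boolP [forall x, (x != o0) ==> [exists i, f i == Some x]].
  have ontof' x : exists i, f i = Some x.
    have [->|x0] := eqVneq x o0; first by exists o0.
    by have /implyP/(_ x0)/existsP[i /eqP] := forallP ontof x; exists i.
  pose g i := odflt o0 (f i).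
  have ginj : injective g.
    have [h fh] := fin_all_exists ontof'.
    have hK : cancel h g by move=> x; rewrite /g fh.
    exact: bij_inj (bij_can_bij (injF_bij (can_inj hK)) hK).
  (* At an undefined point [g] takes the default [o0], which is also its value at 0; injectivity
     makes that point 0, where [f] is defined. *)
  have ftot x : exists y, f x = Some y.
    case fx: (f x) => [y|]; first by exists y.
    have gx : x = o0 by apply: ginj; rewrite /g fx f0.
    by move: fx; rewrite gx f0.
  have [x fx|fid] := pickP (mem (moved f)); last first.
    have -> : f = 1; last exact: base_generated1.
    apply/ffunP=> x; rewrite ptransf_oneE; apply/eqP.
    by have /negbT := fid x; rewrite /= inE negbK.
  rewrite /= inE in fx; have [y fxy] := ftot x.
  have xy : x != y by apply: contra_neq fx => xy; rewrite fxy xy.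
  have x0 : x != o0 by apply: contra_neq fx => ->.
  have y0 : y != o0 by have := fP _ x0; rewrite fxy; apply: contra_neq => ->.
  have [gt _] := base_generated_tperm_upd x0 y0 xy.
  (* Here [f * perm_tr (tperm x y)] fixes x and still fixes each point fixed by [f]: such a point is
     not x, and it is not y because x already maps to y. *)
  have -> : f = f * perm_tr (tperm x y) * perm_tr (tperm x y).
    by rewrite -mulgA -perm_trM tperm2 perm_tr1 mulg1.
  apply: base_generatedM (gt); apply: IHm.
    apply: (decr _ x) => // [|z fz]; rewrite ptransf_mulE ?fxy ?fz /= perm_trE ?tpermR //.
    rewrite tpermD //; first by apply: contra_neq fx => xz; rewrite xz.
    apply: contra_neq fx => yz; have -> : x = z by apply: ginj; rewrite /g fxy fz yz.
    by [].
  apply: base_trM => //; split=> [|z z0]; rewrite perm_trE.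
    by rewrite tpermD.
  by case: tpermP => // *; apply/eqP => -[]; apply/eqP.
rewrite negb_forall => /existsP[x]; rewrite negb_imply negb_exists.
case/andP=> x0 /forallP nfx.
pose g : PT := [ffun z => if z == x then Some x else f z].
have gE z : g z = if z == x then Some x else f z by rewrite ffunE.
have -> : f = g * upd x (f x).
  apply/ffunP=> z; rewrite ptransf_mulE gE; have [->|zx] := eqVneq z x.
    by rewrite /= updE eqxx.
  case fz: (f z) => [y|] //=; rewrite updE; case: eqP => // yx.
  by have := nfx z; rewrite fz yx eqxx.
apply: base_generatedM.
  have fx : f x != Some x := nfx x.
  apply: IHm; first apply: (decr _ x) => //; rewrite ?gE ?eqxx //.
    by move=> z fz; rewrite gE fz; case: eqP => // ->.
  split=> [|i i0]; rewrite gE; first by rewrite eq_sym (negbTE x0).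
  by case: (i =P x) => _; [apply/eqP=> -[] /eqP; rewrite (negbTE x0) | apply: fP].
case fx: (f x) => [y|]; last exact: base_generated_updN.
have y0 : y != o0 by have := fP _ x0; rewrite fx; apply: contra_neq => ->.
have yx : y != x by have := nfx x; rewrite fx; apply: contra_neq => ->.
exact: (base_generated_tperm_upd y0 x0 yx).2.
Qed.

(** * Generation of all strong weak endomorphisms of the star *)

Lemma gen_dE (i : 'I_n) : gen n Ld i = if i == o0 then None else Some i.
Proof.
rewrite ffunE -[_ == 0]/(i == o0); case: eqP => //= _.
by rewrite insubT //= => ?; congr Some; apply: val_inj.
Qed.

Lemma gen_zE (i : 'I_n) : gen n Lz i = Some (if i == o0 then o1 else o0).
Proof.
rewrite ffunE /= -[_ == 0]/(i == o0); case: eqP => _ /=.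
  by rewrite insubT ?ord1_proof //= => ?; congr Some; apply: val_inj.
by rewrite insubT ?ord0_proof //= => ?; congr Some; apply: val_inj.
Qed.

Lemma gen_z0E (i : 'I_n) : gen n Lz0 i = Some o0.
Proof. by rewrite ffunE /= insubT ?ord0_proof //= => ?; congr Some; apply: val_inj. Qed.

Lemma bev_cwE (i : 'I_n) : bev cw i = if i == o0 then Some o0 else None.
Proof.
rewrite bev_cw ffunE -[_ == 0]/(i == o0); case: eqP => //= _.
by rewrite insubT ?ord0_proof //= => ?; congr Some; apply: val_inj.
Qed.

Lemma bev_ewE (i : 'I_n) : bev ew i = Some (if i == o0 then o0 else o1).
Proof.
rewrite bev_ew ffunE /= -[_ == 0]/(i == o0); case: eqP => _ /=.
  by rewrite insubT ?ord0_proof //= => ?; congr Some; apply: val_inj.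
by rewrite insubT ?ord1_proof //= => ?; congr Some; apply: val_inj.
Qed.

Definition generated (f : PT) := exists w, ev w = f.

Lemma generatedM f g : generated f -> generated g -> generated (f * g).
Proof. by move=> [u <-] [v <-]; exists (u * v); rewrite word_evalM. Qed.

Lemma generated_gen x : generated (gen n x).
Proof. by exists (letter_word x); rewrite word_eval_letter. Qed.

Lemma generated_base_tr f : base_tr f -> generated f.
Proof. by case/base_generated_base_tr=> w <-; exists (base_word w); rewrite ev_base. Qed.

Lemma psw_mul f g : is_psw_end (G := star n) f -> is_psw_end (G := star n) g ->
  is_psw_end (G := star n) (f * g).
Proof. exact: (is_psw_end_closed (star n)).2. Qed.

Lemma ev_psw w : is_psw_end (G := star n) (ev w).
Proof.
elim: w => [|x w IHw].
  by rewrite word_eval1; apply: (is_psw_end_closed (star n)).1.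
by rewrite -[x :: w]/(letter_word x * w) word_evalM word_eval_letter;
  apply: psw_mul (gen_psw x) IHw.
Qed.

Lemma star_edge0 i : star_edge o0 i = (i != o0).
Proof. by rewrite /star_edge eq_sym andbT. Qed.

Lemma star_edgeN0 i j : i != o0 -> j != o0 -> star_edge i j = false.
Proof.
by rewrite !neq_o0 /star_edge => /negbTE i0 /negbTE j0; rewrite i0 j0 andbF.
Qed.

(** If some nonzero i is sent to 0, then any nonzero j in the domain, not being adjacent to i, must
    also go to 0. So [f] either lies in the base submonoid or is a partial identity followed by
    [z0]. *)
Lemma generated_fix0 f : is_psw_end (G := star n) f -> f o0 = Some o0 -> generated f.
Proof.
move=> /is_pswP fP f0.
have [fb|] := boolP [forall i, (i != o0) ==> (f i != Some o0)].
  by apply: generated_base_tr; split=> // i i0; apply: (implyP (forallP fb i)).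
rewrite negb_forall => /existsP[i]; rewrite negb_imply negbK => /andP[i0 /eqP fi].
have fO j k : f j = Some k -> k = o0.
  have [->|j0] := eqVneq j o0; first by rewrite f0 => -[].
  move=> fj; have := fP _ _ _ _ fi fj.
  by rewrite star_edgeN0 // star_edge0 => /esym/negbFE/eqP.
pose g : PT := [ffun j => if f j is Some _ then Some j else None].
have -> : f = g * gen n Lz0.
  apply/ffunP=> j; rewrite ptransf_mulE ffunE.
  by case fj: (f j) => [k|] //=; rewrite gen_z0E (fO _ _ fj).
apply: generatedM (generated_gen _); apply: generated_base_tr; split=> [|j j0].
  by rewrite ffunE f0.
by rewrite ffunE; case: (f j) => // _; apply/eqP => -[] /eqP; rewrite (negbTE j0).
Qed.

Lemma generated_psw f : is_psw_end (G := star n) f -> generated f.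
Proof.
move=> pf; have /is_pswP fP := pf.
case f0: (f o0) => [k|]; last first.
  pose g : PT := [ffun i => if i == o0 then Some o0 else f i].
  have gE i : g i = if i == o0 then Some o0 else f i by rewrite ffunE.
  have -> : f = gen n Ld * g.
    apply/ffunP=> i; rewrite ptransf_mulE gen_dE.
    by case: eqP => [-> //|/eqP i0]; rewrite /= gE (negbTE i0).
  apply: generatedM (generated_gen _) _; apply: generated_fix0; last by rewrite gE.
  apply/is_pswP=> u v u' v'; rewrite !gE.
  (* Sending 0 to itself creates no obstruction: 0 is adjacent to exactly the other vertices, so
     both sides only ask whether the other image is nonzero. *)
  case: (eqVneq u o0) => [-> [<-]|u0 fu]; case: (eqVneq v o0) => [-> [<-]|v0 fv].
  - by rewrite !star_edge0 !eqxx.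
  - by rewrite !star_edge0 v0 eq_sym.
  - by rewrite ![star_edge _ o0]star_edge_sym !star_edge0 u0.
  - exact: fP fu fv.
have [k0|k0] := eqVneq k o0; first by apply: generated_fix0; rewrite // f0 k0.
pose t := perm_tr (tperm o1 k).
have t_base : base_tr t.
  have o10 : o1 != o0 by [].
  split=> [|i i0]; rewrite perm_trE; first by rewrite tpermD.
  by case: tpermP => // *; apply/eqP => -[]; apply/eqP.
have [tw twE] := base_generated_base_tr t_base.
have pt : is_psw_end (G := star n) t by rewrite -twE -ev_base; apply: ev_psw.
(* An image a different from k comes from a neighbour of 0, so a is adjacent to k and hence is 0.
   Both 0 and k are fixed by t z z t. *)
have -> : f = f * t * gen n Lz * (gen n Lz * t).
  apply/ffunP=> i; rewrite !ptransf_mulE.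
  case fi: (f i) => [a|] //; have := fP _ _ _ _ f0 fi.
  have [<- _|ka] := eqVneq k a.
    by rewrite /= perm_trE tpermR /= gen_zE /= !ptransf_mulE gen_zE /= perm_trE tpermL.
  have i0 : i != o0 by apply: contra_neq ka => i0; move: fi; rewrite i0 f0 => -[].
  rewrite star_edge0 i0 => /esym.
  have [->|a0] := eqVneq a o0; last by rewrite star_edgeN0.
  rewrite /= perm_trE tpermD //= gen_zE /= !ptransf_mulE gen_zE /=.
  by rewrite perm_trE tpermD.
apply: generatedM; last by apply: generatedM (generated_gen _) (generated_base_tr t_base).
apply: generated_fix0.
  by apply: psw_mul (gen_psw _); apply: psw_mul.
by rewrite !ptransf_mulE f0 /= perm_trE tpermR /= gen_zE.
Qed.

(** * Derived identities in the presented monoid *)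

Section Presentation.
Variable R0 : relations base_letter.
Hypothesis R0_defines : forall u v, congruence R0 u v <-> bev u = bev v.

Local Notation P := (presented (Rsw n R0)).
Local Notation cls := (word_class (Rsw n R0) : free_monoid letter -> P).

(** Evaluates a chosen representative; by soundness ([evp_cls]) the choice does not matter. *)
Definition evp (p : P) : PT := ev (generic_quotient.repr p).

Lemma clsM u v : cls (u * v) = cls u * cls v.
Proof. by rewrite -word_classM. Qed.

Lemma clsX u k : cls (u ^+ k) = cls u ^+ k.
Proof. by elim: k => [//|k IHk]; rewrite !expgS clsM IHk. Qed.

Lemma evp_cls w : evp (cls w) = ev w.
Proof.
apply: (@congruence_sound _ _ _ (Rsw n R0)) => [u v|].
  by apply: Rsw_sound => {}u {}v uv; apply/R0_defines/cong_rel.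
by apply/word_classP; rewrite /word_class reprK.
Qed.

Lemma evpM p q : evp (p * q) = evp p * evp q.
Proof.
elim/word_class_ind: p => u; elim/word_class_ind: q => v.
by rewrite -clsM !evp_cls word_evalM.
Qed.

Definition B (w : free_monoid base_letter) : P := cls (base_word w).
Local Notation D := (cls (letter_word Ld)).
Local Notation Z := (cls (letter_word Lz)).
Local Notation Z0 := (cls (letter_word Lz0)).

Lemma BM u v : B (u * v) = B u * B v.
Proof. by rewrite /B base_wordM clsM. Qed.

Lemma BX u k : B (u ^+ k) = B u ^+ k.
Proof. by rewrite /B base_wordX clsX. Qed.

Lemma evpB w : evp (B w) = bev w.
Proof. by rewrite evp_cls ev_base. Qed.

Lemma cls_rel u v : Rsw n R0 u v -> cls u = cls v.
Proof. by move=> uv; apply/word_classP/cong_rel. Qed.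

(** Completeness of [R0] gives a derivation over the base letters, and [base_word] carries it to one
    for the full relations. *)
Lemma B_eq u v : bev u = bev v -> B u = B v.
Proof.
move=> /R0_defines uv; apply/word_classP; elim: uv => {u v}.
- by move=> u v uv; apply/cong_rel/Rsw_Rs/Rs_R0.
- by move=> u; apply: cong_refl.
- by move=> u v _; apply: cong_sym.
- by move=> u v w _ uv _; apply: cong_trans uv.
- by move=> u u' v v' _ uu' _ vv'; rewrite !base_wordM; apply: cong_mul.
Qed.

Lemma DD : D * D = D.
Proof. by rewrite -clsM; apply/cls_rel/Rsw_Rs/Rs_dd. Qed.

Lemma DB w : D * B w = B w * D.
Proof.
elim: w => [|x w IHw]; first by rewrite mulg1 mul1g.
have xD : B (letter_word x) * D = D * B (letter_word x).
  by rewrite -!clsM; apply/cls_rel/Rsw_Rs; case: x; constructor.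
by rewrite -[x :: w]/(letter_word x * w) BM mulgA -xD -!mulgA IHw.
Qed.

Lemma DZ : D * Z = Z * B (letter_word Lf0).
Proof. by rewrite -!clsM; apply/cls_rel/Rsw_Rs/Rs_dz. Qed.

Lemma ZZ : Z * Z = B ew.
Proof.
by rewrite -clsM /B /ew -lock base_wordM base_wordX base_wordM;
  apply/cls_rel/Rsw_Rs/Rs_zz.
Qed.

Lemma ZD : Z * D = B cw * Z.
Proof.
by rewrite -clsM /B /cw -lock base_wordX base_wordM -clsM; apply/cls_rel/Rsw_Rs/Rs_zd.
Qed.

Lemma ZZ0 : Z * Z0 = Z0.
Proof. by rewrite -clsM; apply/cls_rel/Rsw_zz0. Qed.

Lemma DZ0 : D * Z0 = D * Z.
Proof. by rewrite -!clsM; apply/cls_rel/Rsw_dz0. Qed.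

Lemma Z0D : Z0 * D = D * B cw.
Proof.
by rewrite -clsM /B /cw -lock base_wordX base_wordM -clsM; apply/cls_rel/Rsw_z0d.
Qed.

Lemma Z0B w : Z0 * B w = Z0.
Proof.
elim: w => [|x w IHw]; first by rewrite mulg1.
rewrite -[x :: w]/(letter_word x * w) BM mulgA -[Z0 * _]clsM.
rewrite (_ : cls _ = Z0) //; apply: cls_rel; case: x.
- exact: Rsw_z0a.
- exact: Rsw_z0b.
- exact: Rsw_z0e.
- exact: Rsw_z0f.
Qed.

Lemma EZ : B ew * Z = Z.
Proof.
have eZ : B (letter_word Le0) * Z = Z.
  by rewrite -clsM; apply/cls_rel/Rsw_Rs/Rs_ez.
have bZ : B (letter_word Lb0) * Z = Z.
  by rewrite -clsM; apply/cls_rel/Rsw_Rs/Rs_bz.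
rewrite /ew -lock BM BX BM -mulgA eZ; elim: (n - 3)%N => [|k IHk]; first by rewrite mul1g.
by rewrite expgSr -!mulgA bZ eZ.
Qed.

(** Both sides are z z z, as z z = e and e z = z. *)
Lemma ZE : Z * B ew = Z.
Proof. by rewrite -ZZ mulgA ZZ EZ. Qed.

Lemma EZ0 : B ew * Z0 = Z0.
Proof. by rewrite -ZZ -mulgA !ZZ0. Qed.

Lemma BZ_eq u v : bev (u * ew) = bev (v * ew) -> B u * Z = B v * Z.
Proof. by move=> /B_eq uv; rewrite -EZ !mulgA -!BM uv. Qed.

Lemma BZ0_eq u v : bev (u * ew) = bev (v * ew) -> B u * Z0 = B v * Z0.
Proof. by move=> /B_eq uv; rewrite -EZ0 !mulgA -!BM uv. Qed.

Lemma ZB_eq u v : bev (ew * u) = bev (ew * v) -> Z * B u = Z * B v.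
Proof. by move=> /B_eq uv; rewrite -ZE -!mulgA -!BM uv. Qed.

(** The chain is c z0 = c z z0 = z d z0 = z d z = c z z = c e = c. *)
Lemma CZ0 : B cw * Z0 = B cw.
Proof.
rewrite -{1}ZZ0 mulgA -ZD -mulgA DZ0 mulgA ZD -mulgA ZZ -BM; apply: B_eq.
apply/ffunP=> i; rewrite word_evalM ptransf_mulE bev_cwE.
by case: (i == o0); rewrite //= bev_ewE eqxx.
Qed.

Lemma Z0Z0 : Z0 * Z0 = Z0.
Proof. by rewrite -{1}(Z0B cw) -mulgA CZ0 Z0B. Qed.

Lemma DZB w : D * Z * B w = D * Z0.
Proof. by rewrite -DZ0 -mulgA Z0B. Qed.

(** Since t fixes 0 and keeps nonzero points nonzero, t e = e says that t is defined everywhere; in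
    this form e z = z yields t z = z directly. *)
Definition total (t : free_monoid base_letter) := bev (t * ew) = bev ew.

Lemma totalZ t : total t -> B t * Z = Z.
Proof. by move=> tt; rewrite (@BZ_eq t 1) ?mul1g. Qed.

Lemma totalZ0 t : total t -> B t * Z0 = Z0.
Proof. by move=> tt; rewrite (@BZ0_eq t 1) ?mul1g. Qed.

(** * Reduction of every element to a normal form *)

Definition normal0 (p : P) := exists w, p = B w \/ p = B w * Z0.

Definition normal (p : P) :=
  [\/ normal0 p,
      exists2 x, normal0 x & p = D * x |
      exists2 x, normal0 x & exists2 t, total t & p = x * Z * B t].

Lemma normal0B w : normal0 (B w). Proof. by exists w; left. Qed.

Lemma normal0_Z0 : normal0 Z0.
Proof. by exists 1; right; rewrite mul1g. Qed.

Lemma normal0_mulBl w x : normal0 x -> normal0 (B w * x).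
Proof.
case=> v [] ->; exists (w * v); [left|right]; by rewrite BM ?mulgA.
Qed.

Lemma normal0_mulBr w x : normal0 x -> normal0 (x * B w).
Proof.
case=> v [] ->; first by exists (v * w); left; rewrite BM.
by exists v; right; rewrite -mulgA Z0B.
Qed.

Lemma normal_mulB w p : normal p -> normal (B w * p).
Proof.
case=> [xN|[x xN ->]|[x xN [t tt ->]]].
- by apply: Or31; apply: normal0_mulBl.
- by apply: Or32; exists (B w * x); rewrite ?mulgA ?DB //; apply: normal0_mulBl.
- apply: Or33; exists (B w * x); first exact: normal0_mulBl.
  by exists t; rewrite ?mulgA.
Qed.

Lemma normal_mulD p : normal p -> normal (D * p).
Proof.
case=> [xN|[x xN ->]|[x [w [] ->] [t tt ->]]]; apply: Or32.
- by exists p.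
- by exists x; rewrite // mulgA DD.
(* After d, the factor z t can be replaced by z0. *)
- exists (B w * Z0); first exact/normal0_mulBl/normal0_Z0.
  by rewrite !mulgA DB -!mulgA -(DZB t) !mulgA.
(* After d, the factor z0 can be replaced by z, and z z = e. *)
- exists (B w * B ew * B t); first by rewrite -!BM; apply: normal0B.
  by rewrite !mulgA DB -(mulgA _ D) DZ0 -!mulgA (mulgA Z Z) ZZ.
Qed.

Lemma normal_mulZB p t : total t -> normal p -> normal (p * Z * B t).
Proof.
move=> tt [xN|[x xN ->]|[x xN [s ss ->]]].
- by apply: Or33; exists p => //; exists t.
- rewrite -!mulgA; apply: normal_mulD; apply: Or33; exists x => //.
  by exists t; rewrite ?mulgA.
- rewrite -(mulgA _ (B s)) totalZ // -(mulgA _ Z Z) ZZ.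
  by apply: Or31; do 2!apply: normal0_mulBr.
Qed.

(** By z = z e only e w matters. If w is defined at 1, e w is itself total; otherwise e w = e f0,
    and z f0 = d z = d z0. *)
Lemma ZB_cases w :
  (exists2 t, total t & Z * B w = Z * B t) \/ Z * B w = D * Z0.
Proof.
case w1: (bev w o1) => [k|]; [left|right].
  have k0 : k != o0.
    by have := (base_tr_bev w).2 o1 isT; rewrite w1; apply: contra_neq => ->.
  exists (ew * w).
    apply/ffunP=> i; rewrite !word_evalM !ptransf_mulE bev_ewE.
    case: eqP => _ /=; first by rewrite (base_tr_bev w).1 /= bev_ewE.
    by rewrite w1 /= bev_ewE (negbTE k0).
  apply: ZB_eq; apply/ffunP=> i.
  rewrite !word_evalM !ptransf_mulE bev_ewE /= ptransf_mulE.
  by rewrite bev_ewE; case: (i == o0).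
rewrite DZ0 DZ; apply: ZB_eq; apply/ffunP=> i.
rewrite !word_evalM !ptransf_mulE bev_ewE word_eval_letter /=.
case: eqP => _; first by rewrite (base_tr_bev w).1 (base_tr_gen Lf0).1.
by rewrite w1 -upd_f updE eqxx.
Qed.

Lemma normal_mulZ p : normal p -> normal (Z * p).
Proof.
have mulZ0 x : normal0 x -> normal (Z * x).
  case=> w [] ->; have [[t tt ZwE]|ZwE] := ZB_cases w; rewrite ?mulgA ZwE.
  - by apply: Or33; exists 1; [apply: (normal0B 1) | exists t; rewrite ?mul1g].
  - by apply: Or32; exists Z0 => //; apply: normal0_Z0.
  - by apply: Or31; rewrite -mulgA totalZ0 // ZZ0; apply: normal0_Z0.
  - by apply: Or32; exists Z0; [apply: normal0_Z0 | rewrite -mulgA Z0Z0].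
case=> [/mulZ0 //|[x xN ->]|[x xN [t tt ->]]].
- by rewrite mulgA ZD -mulgA; apply/normal_mulB/mulZ0.
- by rewrite !mulgA; apply: normal_mulZB; last exact: mulZ0.
Qed.

Lemma normal_mulZ0 p : normal p -> normal (Z0 * p).
Proof.
have mulZ0 x : normal0 x -> Z0 * x = Z0.
  by case=> w [] ->; rewrite ?mulgA Z0B ?Z0Z0.
case=> [/mulZ0 -> |[x xN ->]|[x xN [t tt ->]]].
- by apply: Or31; apply: normal0_Z0.
- apply: Or32; exists (B cw * x); first exact: normal0_mulBl.
  by rewrite mulgA Z0D mulgA.
- by apply: Or33; exists Z0; [apply: normal0_Z0 | exists t; rewrite // !mulgA (mulZ0 x)].
Qed.

Lemma normal_all p : normal p.
Proof.
elim/word_class_ind: p => w; elim: w => [|x w IHw]; first exact/Or31/(normal0B 1).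
rewrite -[x :: w]/(letter_word x * w) clsM; case: x.
- by move=> x; apply: (normal_mulB (letter_word x)).
- exact: normal_mulD.
- exact: normal_mulZ.
- exact: normal_mulZ0.
Qed.

(** * Injectivity of evaluation, by comparing normal forms *)

Lemma evpZ0 i : evp Z0 i = Some o0.
Proof. by rewrite evp_cls word_eval_letter gen_z0E. Qed.

Lemma normal0_o0 x : normal0 x -> evp x o0 = Some o0.
Proof.
by case=> w [] ->; rewrite ?evpM ?ptransf_mulE evpB (base_tr_bev w).1 //= evpZ0.
Qed.

Lemma normal0_inj x y : normal0 x -> normal0 y -> evp x = evp y -> x = y.
Proof.
(* Only 0 is sent to 0 by u, whereas v z0 has no other value. So u and v have domain {0}, both act
   as c, and c z0 = c. *)
have neqB u v : bev u = evp (B v * Z0) -> B u = B v * Z0.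
  move=> uv; have uvN i : i != o0 -> bev u i = None /\ bev v i = None.
    move=> i0; have := (base_tr_bev u).2 i i0.
    rewrite uv evpM ptransf_mulE evpB; case: (bev v i) => //= k.
    by rewrite evpZ0 eqxx.
  have uC : bev u = bev cw.
    apply/ffunP=> i; rewrite bev_cwE; case: eqP => [-> |/eqP /uvN[] //].
    exact: (base_tr_bev u).1.
  rewrite (B_eq uC) -CZ0; apply: BZ0_eq; apply/ffunP=> i.
  rewrite !word_evalM !ptransf_mulE bev_cwE; case: eqP => [-> |/eqP /uvN[_ -> //]].
  by rewrite (base_tr_bev v).1.
case=> u [] -> [v [] ->]; rewrite 1?evpB => uv.
- by apply: B_eq; rewrite uv evpB.
- exact: neqB.
- by apply/esym/neqB; rewrite uv.
(* The value of u z0 determines the domain of u, and u e depends on that domain alone. *)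
apply: BZ0_eq; apply/ffunP=> i; move/ffunP/(_ i): uv.
rewrite !word_evalM !evpM !ptransf_mulE !evpB.
have [->|i0] := eqVneq i o0; first by rewrite !(base_tr_bev _).1.
have := (base_tr_bev u).2 i i0; have := (base_tr_bev v).2 i i0.
case: (bev u i) (bev v i) => [a|] [b|] //=; rewrite ?evpZ0 //.
by rewrite !bev_ewE => b0 a0 _; rewrite !ifN.
Qed.

Lemma evpD_o0 x : evp (D * x) o0 = None.
Proof. by rewrite evpM ptransf_mulE evp_cls word_eval_letter gen_dE. Qed.

Lemma evpD x i : i != o0 -> evp (D * x) i = evp x i.
Proof.
by move=> /negbTE i0; rewrite evpM ptransf_mulE evp_cls word_eval_letter gen_dE i0.
Qed.

Lemma evpZB_o0 x t : normal0 x -> evp (x * Z * B t) o0 = bev t o1.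
Proof.
move=> /normal0_o0 x0; rewrite !evpM !ptransf_mulE x0 /= evp_cls word_eval_letter.
by rewrite gen_zE /= evpB.
Qed.

Lemma total_o1 t : total t -> exists2 k, bev t o1 = Some k & k != o0.
Proof.
move=> /ffunP/(_ o1); rewrite word_evalM ptransf_mulE bev_ewE.
have := (base_tr_bev t).2 o1 isT.
by case: (bev t o1) => [k|] //= k0 _; exists k => //; apply: contra_neq k0 => ->.
Qed.

Lemma evp_inj : injective evp.
Proof.
have ZBN0 x t : normal0 x -> total t ->
    exists2 k, evp (x * Z * B t) o0 = Some k & k != o0.
  by move=> xN /total_o1[k tk k0]; exists k; rewrite ?evpZB_o0.
move=> p q; case: (normal_all p) => [pN|[x xN ->]|[x xN [t tt ->]]];
  case: (normal_all q) => [qN|[y yN ->]|[y yN [s ss ->]]] pq;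
  have := congr1 (fun f : PT => f o0) pq; rewrite ?evpD_o0.
- by move=> _; apply: normal0_inj.
- by rewrite normal0_o0.
- by rewrite normal0_o0 //; have [k -> /eqP k0] := ZBN0 _ _ yN ss; case=> /esym.
- by rewrite normal0_o0.
- move=> _; congr (_ * _); apply: normal0_inj => //; apply/ffunP=> i.
  have [->|i0] := eqVneq i o0; first by rewrite !normal0_o0.
  by rewrite -(evpD x i0) -(evpD y i0) pq.
- by have [k ->] := ZBN0 _ _ yN ss.
- by rewrite (normal0_o0 qN); have [k -> /eqP k0] := ZBN0 _ _ xN tt; case.
- by have [k ->] := ZBN0 _ _ xN tt.
rewrite !evpZB_o0 // => ts.
(* The images of 0 give 1 t = 1 s, so e t = e s. *)
have ZBE : Z * B t = Z * B s.
  apply: ZB_eq; apply/ffunP=> i; rewrite !word_evalM !ptransf_mulE bev_ewE /=.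
  by case: (i == o0); rewrite // !(base_tr_bev _).1.
rewrite -!mulgA ZBE !mulgA; congr (_ * _).
(* Multiplying once more by z recovers x z, because z z z = z. *)
suff xy : x * Z * Z = y * Z * Z by rewrite -EZ -ZZ !mulgA xy.
have totalZZ u r : total r -> u * Z * B r * Z = u * Z * Z.
  by move=> tr; rewrite -mulgA totalZ.
apply: normal0_inj; first by rewrite -mulgA ZZ; apply: normal0_mulBr.
  by rewrite -mulgA ZZ; apply: normal0_mulBr.
by rewrite -(totalZZ x t) // -(totalZZ y s) // evpM pq -evpM.
Qed.

(** * The isomorphism onto the monoid of strong weak endomorphisms *)

Lemma evp_psw p : is_psw_end (G := star n) (evp p).
Proof. exact: ev_psw. Qed.

Definition to_psw (p : P) : psw_end (star n) := PswEnd (evp_psw p).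

Fact to_psw_monoid_morphism : monoid_morphism to_psw.
Proof.
split; first by apply: val_inj; rewrite /= (evp_cls 1) word_eval1.
by move=> p q; apply: val_inj; rewrite /= evpM.
Qed.

Lemma to_psw_bij : bijective to_psw.
Proof.
have surj (f : psw_end (star n)) : exists p, to_psw p = f.
  case: f => f pf; have [w wf] := generated_psw pf.
  by exists (cls w); apply: val_inj; rewrite /= evp_cls.
exists (fun f => projT1 (cid (surj f))) => [p|f]; last by case: cid.
by case: cid => q /= /(congr1 val) /evp_inj.
Qed.

End Presentation.

End Star.

Theorem theorem4p3 (n : nat) (n_ge3 : 3 <= n) (R0 : relations base_letter)
    (R0_defines : forall u v : free_monoid base_letter,
       congruence R0 u v <->
       word_eval (base_gen n) u = word_eval (base_gen n) v) :
  exists phi : UMagmaMorphism.type (presented (Rsw n R0)) (psw_end (star n)),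
    bijective phi /\
    forall x : letter,
      psw_val (phi (word_class (Rsw n R0) (letter_word x))) = gen n x.
Proof.
pose phiM := isUMagmaMorphism.Build _ _ _ (to_psw_monoid_morphism n_ge3 R0_defines).
pose phi : UMagmaMorphism.type (presented (Rsw n R0)) (psw_end (star n)) :=
  HB.pack (@to_psw n n_ge3 R0) phiM.
exists phi; split; first exact: (to_psw_bij n_ge3 R0_defines).
by move=> x; rewrite /= (evp_cls n_ge3 R0_defines) word_eval_letter.
Qed.
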